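(* Let $h$ be a Herglotz function, i.e. a holomorphic map of the open upper half-plane $\mathbb{C}_+$ into itself. For each $r\in\mathbb{R}$ let $g_r(z) := (r-h(z))^{-1}$, $z\in\mathbb{C}_+$, which is again a Herglotz function; let $\mu_r$ be the positive Borel measure on $\mathbb{R}$ corresponding to $g_r$ via the Herglotz representation formula, and let $\mu_r^{(s)}$ be the singular part of $\mu_r$ (with respect to Lebesgue measure on $\mathbb{R}$). Then the averaged measure $$ \int_0^1 \mu_r^{(s)}\,dr $$ is absolutely continuous (with respect to Lebesgue measure), and its density is a function which takes values $0$ or $1$ almost everywhere.
   Context: $\mathbb{C}_+=\{z\in\mathbb{C}:\operatorname{Im} z>0\}$. Herglotz representation: for any Herglotz function $f$ there exist a unique non-negative real number $\alpha$, a unique real number $\beta_i$ and a unique positive Borel measure $\mu$ on $\mathbb{R}$ obeying $\int_{\mathbb{R}} \frac{1}{1+\lambda^2}\,d\mu(\lambda)<\infty$ such that $$ f(z)=\alpha z+\beta_i+\int_{\mathbb{R}}\left(\frac{1}{\lambda-z}-\frac{\lambda}{\lambda^2+1}\right)d\mu(\lambda),\qquad z\in\mathbb{C}_+ . $$ The measure $\mu$ (with this normalization, without a factor $1/\pi$) is the measure corresponding to $f$. The averaged measure $\int_0^1 \mu_r^{(s)}\,dr$ is the Borel measure $\Delta\mapsto\int_0^1\mu_r^{(s)}(\Delta)\,dr$ on $\mathbb{R}$, where $dr$ is Lebesgue measure. The singular part $\mu_r^{(s)}$ is the one in the Lebesgue decomposition of $\mu_r$ (it includes both the pure point and singular continuous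 parts). *)

(* Defs.v *)
From HB Require Import structures.
From mathcomp Require Import all_boot all_order all_algebra.
From mathcomp Require Import complex.
From mathcomp Require Import all_classical all_reals all_analysis.
From mathcomp Require Import measurable_realfun.

Set Implicit Arguments.
Unset Strict Implicit.
Unset Printing Implicit Defensive.

Import Order.TTheory GRing.Theory Num.Theory.
Import numFieldNormedType.Exports.

Local Open Scope classical_set_scope.
Local Open Scope ring_scope.
Local Open Scope complex_scope.

Definition upper_half_plane (R : realType) : set R[i] :=
  [set z | 0 < complex.Im z].

(* A function on the open upper half-plane is encoded as a total function on
   R[i] whose values outside the half-plane are irrelevant.  On R[i]^o, the
   field R[i] seen as a normed space over itself, [derivable f z 1] is complex
   differentiability at z. *)
Definition herglotz (R : realType) (f : R[i] -> R[i]) : Prop :=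
  forall z, upper_half_plane z ->
    derivable (f : R[i]^o -> R[i]^o) z 1 /\ upper_half_plane (f z).

(* Integral of a complex-valued function, by real and imaginary parts; it is
   the usual one as soon as both parts are mu-integrable. *)
Definition complex_integral (R : realType)
    (mu : {measure set (measurableTypeR R) -> \bar R}) (f : R -> R[i]) : R[i] :=
  Rintegral mu setT (fun l => complex.Re (f l))
  +i* Rintegral mu setT (fun l => complex.Im (f l)).

(* The sigma-algebra of [measurableTypeR R] is the Borel one.  The second
   condition makes both parts of the kernel mu-integrable for every z in the
   upper half-plane. *)
Definition herglotz_representation (R : realType) (f : R[i] -> R[i])
    (alpha beta : R) (mu : {measure set (measurableTypeR R) -> \bar R}) : Prop :=
  [/\ 0 <= alpha,
      (\int[mu]_l ((1 + (l : R) ^+ 2)^-1)%:E < +oo)%E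
    & forall z, upper_half_plane z ->
        f z = alpha%:C * z + beta%:C
              + complex_integral mu
                  (fun l => (l%:C - z)^-1 - (l / (l ^+ 2 + 1))%:C) ].

Definition measure_of_herglotz (R : realType) (f : R[i] -> R[i])
    (mu : {measure set (measurableTypeR R) -> \bar R}) : Prop :=
  exists alpha beta : R, herglotz_representation f alpha beta mu.

Definition mutually_singular d (T : measurableType d) (R : realType)
    (mu nu : {measure set T -> \bar R}) : Prop :=
  exists N : set T, [/\ measurable N, mu N = 0%E & nu (~` N) = 0%E].

Definition singular_part (R : realType)
    (mu mus : {measure set (measurableTypeR R) -> \bar R}) : Prop :=
  mutually_singular mus lebesgue_measure /\
  exists muac : {measure set (measurableTypeR R) -> \bar R},
    muac `<< lebesgue_measure /\
    forall A, measurable A -> mu A = (muac A + mus A)%E.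

Definition density (R : realType)
    (nu : {measure set (measurableTypeR R) -> \bar R}) (f : R -> R) : Prop :=
  [/\ measurable_fun [set: measurableTypeR R] f,
      forall x, 0 <= f x
    & forall A : set (measurableTypeR R), measurable A ->
        nu A = (\int[lebesgue_measure]_(x in A) (f x)%:E)%E ].

Definition herglotz_family (R : realType) (h : R[i] -> R[i]) (r : R) :
    R[i] -> R[i] :=
  fun z => (r%:C - h z)^-1.

(* nu = int_0^1 m_r dr.  The measurability clause is part of the definition
   because the library's integral is also defined (as a lower integral) for
   non-measurable non-negative integrands. *)
Definition averaged_measure (R : realType)
    (m : R -> {measure set (measurableTypeR R) -> \bar R})
    (nu : {measure set (measurableTypeR R) -> \bar R}) : Prop :=
  forall A : set (measurableTypeR R), measurable A ->
    measurable_fun (`[0, 1]%classic : set (measurableTypeR R))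
       ((fun r => m r A) : measurableTypeR R -> \bar R) /\
    nu A = (\int[lebesgue_measure]_(r in `[0%R, 1%R]%classic) m r A)%E.

(* Main.v *)
Require Import Defs.
From HB Require Import structures.
From mathcomp Require Import all_boot all_order all_algebra.
From mathcomp Require Import complex.
From mathcomp Require Import all_classical all_reals all_analysis.
From mathcomp Require Import measurable_realfun.
From mathcomp Require Import ring lra.

Set Implicit Arguments.
Unset Strict Implicit.
Unset Printing Implicit Defensive.

Import Order.TTheory GRing.Theory Num.Theory.
Import numFieldNormedType.Exports.

Local Open Scope classical_set_scope.
Local Open Scope ring_scope.

(** Write [g_r = (r - h)^-1], with measure [mu r], and let [x] approach the
boundary along the points [x + i 2^-n].  Two facts give the result.

_Averaging._ By the representation formula, the Poisson integral of [mu r] at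
[z] is [Im (g_r z) - alpha_r Im z], and [Im (g_r z)] is the Poisson kernel of
the point [h z] evaluated at [r].  Its integral over all real [r] is therefore
[pi], whatever [h] and [z] are, and [alpha_r] vanishes for all [r] but at most
one.  Stieltjes inversion recovers [mu r] on half-open intervals from these
Poisson integrals, so that [r |-> mu r A] is measurable and the integral of
[mu r] over all real [r] is Lebesgue measure ([integral_mu]).

_Localization._ The singular part of [mu r] lives on the set [limit_set h r]
where [h (x + i 2^-n)] tends to [r], because the Poisson integral of a measure
tends to infinity almost everywhere with respect to its singular part
([singular_limit_set]).  On the other hand, [mu r] vanishes on any set where
[Im (h (x + i 2^-n))] tends to [0] while [h (x + i 2^-n)] does not tend to [r],
because there the Poisson integral is arbitrarily small along a subsequence
([measure_limit_ne]).  Both statements are differentiation theorems for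
measures, and a stopping-time argument on dyadic intervals is enough for them
([le_measure_dyadic_density]).

Let [E] be the set of [x] where the distance of [h (x + i 2^-n)] to the segment
[[0, 1]] tends to [0].  For [r] outside the segment, [mu r E = 0].  For [r] in
the segment, [mu r] restricted to [E] is carried by [limit_set h r]; this set is
Lebesgue-null, since the averaging formula computes its Lebesgue measure from
the numbers [mu s (limit_set h r)], which vanish for [s != r].  Hence the
restriction of [mu r] to [E] is exactly the singular part.  Averaging the
singular parts over [[0, 1]] thus amounts to averaging [mu r (A `&` E)] over all
real [r], which yields the Lebesgue measure of [A `&` E]: the density is the
indicator function of [E]. *)

(** * Comparison of measures along dyadic intervals *)

Section dyadic_cover.
Context {R : realType}.
Implicit Types (n : nat) (k : int) (x : R).

Definition dyadic n k : set R :=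
  `[k%:~R / 2 ^+ n, (k + 1)%:~R / 2 ^+ n[%classic.

Definition dyadic_index n x : int := Num.floor (x * 2 ^+ n).

Lemma dyadicP n k x : dyadic n k x <-> dyadic_index n x = k.
Proof.
have n2 : 0 < 2 ^+ n :> R by rewrite exprn_gt0.
rewrite /dyadic /dyadic_index /= in_itv /= ler_pdivrMr// ltr_pdivlMr// -floor_eq.
by split=> [/eqP|->].
Qed.

Lemma measurable_dyadic n k : measurable (dyadic n k).
Proof. exact: measurable_itv. Qed.

Lemma lebesgue_measure_dyadic n k :
  lebesgue_measure (dyadic n k) = (2 ^- n)%:E.
Proof.
rewrite lebesgue_measure_itv/= lte_fin ltr_pM2r ?invr_gt0 ?exprn_gt0//.
rewrite ltr_int ltrDl ltr01 -EFinB -mulrBl; congr EFin.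
by rewrite -intrB addrAC subrr add0r mul1r.
Qed.

Lemma dyadic_dist n x t :
  dyadic n (dyadic_index n x) t -> `|t - x| < 2 ^- n.
Proof.
move=> /dyadicP tx; have n2 : 0 < 2 ^+ n :> R by rewrite exprn_gt0.
have /andP[x1 x2] := floor_itv (x * 2 ^+ n).
have /andP[t1 t2] := floor_itv (t * 2 ^+ n).
rewrite -(ltr_pM2r n2) mulVf ?gt_eqF// -[X in _ * X]gtr0_norm// -normrM mulrBl.
rewrite /dyadic_index in tx; rewrite tx in t1 t2.
rewrite rmorphD/= in x2 t2.
by rewrite ltr_norml; apply/andP; split; lra.
Qed.

Lemma dyadic_index_le m n x t : (m <= n)%N ->
  dyadic_index n x = dyadic_index n t -> dyadic_index m x = dyadic_index m t.
Proof.
move=> /subnK <-; elim: (n - m)%N => [//|j IH]; rewrite addSn => eqxt; apply: IH.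
move: eqxt; rewrite /dyadic_index exprS !(mulrCA _ 2).
set a := x * _; set b := t * _ => eqab.
(* The integer part of [2 * a] determines that of [a]. *)
apply/esym/floor_def.
have /andP[a1 a2] := floor_itv a.
have /andP[b1 b2] := floor_itv (2 * b).
have /andP[c1 c2] := floor_itv (2 * a).
rewrite -eqab in b1 b2.
have h1 : 2 * Num.floor a <= Num.floor (2 * a).
  by rewrite floor_ge_int intrM; lra.
have h2 : Num.floor (2 * a) < 2 * Num.floor a + 2.
  by rewrite -(ltr_int R) rmorphD /= intrM; rewrite rmorphD/= in a2; lra.
have h3 : Num.floor (2 * a) + 1 <= 2 * Num.floor a + 2 by rewrite lezD1.
rewrite -(ler_int R) in h1; rewrite -(ler_int R) in h3.
rewrite !rmorphD /= intrM in h3; rewrite intrM in h1; rewrite !rmorphD/= in b2 *.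
by apply/andP; split; lra.
Qed.

(** Two dyadic intervals are nested or disjoint.  The coarsest admissible
intervals around the points of [A] therefore form a countable disjoint family,
on which the comparison of [mu] with Lebesgue measure can be summed. *)
Lemma dyadic_stopping_cover (mu : {measure set (measurableTypeR R) -> \bar R})
    (A U : set (measurableTypeR R)) (c : R) : 0 <= c ->
  measurable A -> measurable U ->
  (forall x, A x -> exists n, dyadic n (dyadic_index n x) `<=` U /\
     (mu (dyadic n (dyadic_index n x)) <= (c * 2 ^- n)%:E)%E) ->
  (mu A <= c%:E * lebesgue_measure U)%E.
Proof.
move=> c0 mA mU AU.
pose good n k := dyadic n k `<=` U /\ (mu (dyadic n k) <= (c * 2 ^- n)%:E)%E.
(* An admissible interval is kept when it meets no coarser admissible one. *)
pose stop n k := good n k /\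
  forall m x, (m < n)%N -> dyadic n k x -> ~ good m (dyadic_index m x).
(* Scales and indices are enumerated together, so that one countable union
   is enough; the numbers that encode no pair give the empty set. *)
pose F (i : nat) : set (measurableTypeR R) :=
  if @pickle_inv (nat * int)%type i is Some p then
    [set x | stop p.1 p.2 /\ dyadic p.1 p.2 x] else set0.
have FE i : F i = set0 \/ exists2 p : nat * int,
    pickle_inv i = Some p & stop p.1 p.2 /\ F i = dyadic p.1 p.2.
  rewrite /F; case: (pickle_inv i) => [p|]; last by left.
  have [sp|nsp] := pselect (stop p.1 p.2).
    by right; exists p => //; split => //; apply/seteqP; split => x //= [].
  by left; apply/seteqP; split => x //= [].
have mF i : measurable (F i).
  have [->//|[p _ [_ ->]]] := FE i; exact: measurable_dyadic.
have tF : trivIset setT F.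
  apply/trivIsetP => i j _ _ ij.
  have [->|[p ip [[gp sp] ->]]] := FE i; first by rewrite set0I.
  have [->|[q jq [[gq sq] ->]]] := FE j; first by rewrite setI0.
  apply/seteqP; split => // x [xp xq].
  have /dyadicP xp' := xp; have /dyadicP xq' := xq.
  have [pq|qp|pq] := ltngtP p.1 q.1.
  - by apply: (sq p.1 x pq xq); rewrite xp'.
  - by apply: (sp q.1 x qp xp); rewrite xq'.
  - have pq' : p = q.
      by rewrite (surjective_pairing p) (surjective_pairing q) -xp' -xq' pq.
    move/eqP: ij; apply.
    have := @pickle_invK (nat * int)%type i; rewrite ip /= pq' => <-.
    by have := @pickle_invK (nat * int)%type j; rewrite jq.
have AF : A `<=` \bigcup_i F i.
  move=> x Ax.
  have ex : exists n, `[< good n (dyadic_index n x) >].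
    by have [n gn] := AU _ Ax; exists n; exact/asboolP.
  case: (ex_minnP ex) => n /asboolP gn minn.
  exists (pickle (n, dyadic_index n x)) => //; rewrite /F pickleK_inv/=.
  split; last exact/dyadicP.
  split=> // m t mn /dyadicP tx gm.
  suff /minn : `[< good m (dyadic_index m x) >] by rewrite leqNgt mn.
  by apply/asboolP; rewrite -(dyadic_index_le (ltnW mn) tx).
have FU : \bigcup_i F i `<=` U.
  move=> x [i _]; have [->//|[p _ [[[pU _] _] ->]]] := FE i; exact: pU.
have mbF : measurable (\bigcup_i F i) by exact: bigcup_measurable.
have Fc i : (mu (F i) <= c%:E * lebesgue_measure (F i))%E.
  have [->|[p _ [[[_ ?] _] ->]]] := FE i; first by rewrite !measure0 mule0.
  by rewrite lebesgue_measure_dyadic -EFinM.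
apply: (@le_trans _ _ (mu (\bigcup_i F i))); first by apply: le_measure; rewrite ?inE.
apply: (@le_trans _ _ (c%:E * lebesgue_measure (\bigcup_i F i))%E).
  rewrite !measure_semi_bigcup// -nneseriesZl//.
  by apply: lee_nneseries => // i _; apply: Fc.
by apply: lee_wpmul2l; rewrite ?lee_fin//; apply: le_measure; rewrite ?inE.
Qed.

(** Outer regularity of Lebesgue measure provides an open set that is hardly
larger than [A] and contains all small dyadic intervals around points of [A]. *)
Lemma le_measure_dyadic_density
    (mu : {measure set (measurableTypeR R) -> \bar R})
    (A : set (measurableTypeR R)) (c : R) : 0 <= c ->
  measurable A -> (lebesgue_measure A < +oo)%E ->
  (forall x, A x -> forall N, exists2 n, (N <= n)%N &
     (mu (dyadic n (dyadic_index n x)) <= (c * 2 ^- n)%:E)%E) ->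
  (mu A <= c%:E * lebesgue_measure A)%E.
Proof.
move=> c0 mA Aoo Ac; apply/lee_addgt0Pr => e e0.
have e1 : 0 < e / (c + 1) by rewrite divr_gt0// ltr_wpDl.
have [U [oU AU UA]] := lebesgue_regularity_outer mA Aoo e1.
have mU : measurable (U : set (measurableTypeR R)) by exact: open_measurable.
apply: (@le_trans _ _ (c%:E * lebesgue_measure U)%E).
  apply: dyadic_stopping_cover => // x Ax.
  have /nbhs_ballP[d /= d0 dU] : nbhs x U by apply: open_nbhs_nbhs; split => //; exact: AU.
  have [N _ Nd] : \forall n \near \oo, (2 ^- n : R) < d.
    have : (fun n => (2 ^-1 ^+ n : R)) @ \oo --> (0 : R).
      by apply: cvg_expr; rewrite ger0_norm ?invf_lt1 ?ltr1n// invr_ge0.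
    move=> /cvgrPdist_lt/(_ _ d0)[N _ H]; exists N => // n Nn.
    by have := H n Nn; rewrite sub0r normrN exprVn ger0_norm// invr_ge0 exprn_ge0.
  have [n Nn nc] := Ac x Ax N; exists n; split => // t /dyadic_dist tx.
  by apply: dU; rewrite /ball/= distrC (lt_trans tx)//; apply: Nd.
have -> : U = A `|` (U `\` A) :> set R by rewrite setDUK.
have AD0 : A `&` (U `\` A) = set0 by rewrite -subset0 => t [At [_ /(_ At)]].
have mUA : measurable (U `\` A : set (measurableTypeR R)) by exact: measurableD.
rewrite measureU//.
rewrite ge0_muleDr// leeD2l//.
apply: (@le_trans _ _ (c%:E * (e / (c + 1))%:E)%E).
  by apply: lee_wpmul2l; rewrite ?lee_fin// ltW.
rewrite -EFinM lee_fin mulrCA ler_piMr ?(ltW e0)// ler_pdivrMr ?mul1r ?lerDl// ltr_wpDl//.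
Qed.

End dyadic_cover.

(** * The Poisson kernel of the upper half-plane *)

Section poisson.
Context {R : realType}.
Implicit Types (u v x y l r a b : R).

(** The imaginary part of [(l - (x + i y))^-1], that is [pi] times the
probability density of the Cauchy law with location [x] and scale [y]. *)
Definition poisson x y l : R := y / ((l - x) ^+ 2 + y ^+ 2).

Lemma poisson_den_gt0 x y l : 0 < y -> 0 < (l - x) ^+ 2 + y ^+ 2.
Proof. by move=> y0; rewrite ltr_wpDl ?sqr_ge0// exprn_gt0. Qed.

Lemma poisson_ge0 x y l : 0 <= y -> 0 <= poisson x y l.
Proof. by move=> y0; rewrite divr_ge0// addr_ge0 ?sqr_ge0. Qed.

Lemma poissonC x y l : poisson x y l = poisson l y x.
Proof. by rewrite /poisson -opprB sqrrN. Qed.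

Lemma measurable_poisson d (T : measurableType d) (D : set T) (f g h : T -> R) :
  measurable_fun D f -> measurable_fun D g -> measurable_fun D h ->
  measurable_fun D (fun t => poisson (f t) (g t) (h t)).
Proof.
move=> mf mg mh; rewrite /poisson; apply: measurable_funM => //.
(* On non-negative denominators, inversion is the real power of exponent [-1]. *)
rewrite (_ : (fun t => _) =
    (@powR R ^~ (- 1)) \o (fun t => (h t - f t) ^+ 2 + g t ^+ 2)); last first.
  by apply/funext => t /=; rewrite powR_inv1// addr_ge0 ?sqr_ge0.
apply: measurableT_comp; first exact: measurable_powR.
by apply: measurable_funD; apply: measurable_funX => //; exact: measurable_funB.
Qed.

(** What counts is the decay in [l], which makes the kernel integrable for every
measure that integrates [(1 + l ^+ 2)^-1]. *)
Lemma poisson_le x y l : 0 < y ->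
  poisson x y l <=
    y * (2 + (1 + 2 * x ^+ 2) / y ^+ 2) * (1 + l ^+ 2)^-1.
Proof.
move=> y0; rewrite /poisson -mulrA ler_pM2l//.
have d0 := poisson_den_gt0 x l y0.
have l0 : 0 < 1 + l ^+ 2 by rewrite ltr_pwDl ?sqr_ge0.
rewrite ler_pdivlMr// mulrC ler_pdivrMr//.
have y2 : 0 < y ^+ 2 by rewrite exprn_gt0.
rewrite mulrDl mulrDr [in leRHS]mulrAC.
have -> : (1 + 2 * x ^+ 2) * ((l - x) ^+ 2 + y ^+ 2) / y ^+ 2 =
    (1 + 2 * x ^+ 2) * (l - x) ^+ 2 / y ^+ 2 + (1 + 2 * x ^+ 2).
  by field; rewrite gt_eqF.
have : 0 <= (1 + 2 * x ^+ 2) * (l - x) ^+ 2 / y ^+ 2.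
  by rewrite divr_ge0 ?(ltW y2)// mulr_ge0 ?sqr_ge0// addr_ge0// mulr_ge0 ?sqr_ge0.
(* [2 * (l - x) ^+ 2 + 2 * x ^+ 2 - l ^+ 2] is the square of [l - 2 * x]. *)
have := sqr_ge0 (l - 2 * x).
by nra.
Qed.

Lemma poisson_ge x y l : 0 < y -> `|l - x| <= y -> (2 * y)^-1 <= poisson x y l.
Proof.
move=> y0 lx; have d0 := poisson_den_gt0 x l y0.
rewrite /poisson ler_pdivlMr// mulrC ler_pdivrMr ?mulr_gt0//.
have : `|l - x| ^+ 2 <= y ^+ 2 by rewrite ler_pXn2r ?nnegrE// ltW.
by rewrite real_normK ?num_real//; nra.
Qed.

Lemma poisson_le_dist x y l : 0 < y -> 2 * `|l - x| * poisson x y l <= 1.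
Proof.
move=> y0; have d0 := poisson_den_gt0 x l y0.
rewrite /poisson mulrA ler_pdivrMr// mul1r -(real_normK (num_real (l - x))).
have := sqr_ge0 (`|l - x| - y); nra.
Qed.

Lemma poisson_le_height x y l : 0 < y -> y * poisson x y l <= 1.
Proof.
move=> y0; have d0 := poisson_den_gt0 x l y0.
by rewrite /poisson mulrA ler_pdivrMr// mul1r -expr2 lerDr sqr_ge0.
Qed.

Lemma poisson_le_far x y l (d : R) : 0 < y -> 0 < d -> d <= `|l - x| ->
  poisson x y l <= y / d ^+ 2.
Proof.
move=> y0 d0 dlx; rewrite /poisson ler_pM2l// lef_pV2 ?posrE ?exprn_gt0//; last first.
  exact: poisson_den_gt0.
rewrite -(real_normK (num_real (l - x))) (le_trans (y := `|l - x| ^+ 2))//.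
  by rewrite ler_pXn2r ?nnegrE// ltW.
by rewrite lerDl sqr_ge0.
Qed.

Lemma poisson01 l : poisson 0 1 l = (1 + l ^+ 2)^-1.
Proof. by rewrite /poisson subr0 expr1n div1r addrC. Qed.

Lemma poissonE x y l : y != 0 ->
  poisson x y l = (oneDsqr ((l - x) / y))^-1 * y^-1.
Proof.
move=> y0; rewrite /poisson /oneDsqr.
have d0 : (l - x) ^+ 2 + y ^+ 2 != 0.
  by rewrite gt_eqF// ltr_wpDl ?sqr_ge0// exprn_even_gt0.
by field; rewrite y0 addrC.
Qed.

Lemma is_derive_scale x y (l : R) : is_derive l 1 (fun l => (l - x) / y) y^-1.
Proof. by apply: is_derive_eq; rewrite scaler0 add0r subr0 [LHS]mulr1. Qed.

Lemma integral_oneDsqrV :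
  (\int[@lebesgue_measure R]_x (oneDsqr x)^-1%:E = pi%:E)%E.
Proof.
rewrite ge0_symfun_integralT.
- by rewrite -set_itvcy integral0y_oneDsqr -EFinM mulrC divfK.
- by move=> x; rewrite invr_ge0.
- exact: continuous_oneDsqrV.
- by move=> x; rewrite /= /oneDsqr sqrrN.
Qed.

Lemma integral_poisson x y : 0 < y ->
  (\int[lebesgue_measure]_l (poisson x y l)%:E = pi%:E)%E.
Proof.
move=> y0; rewrite -integral_oneDsqrV.
pose F (l : R) := (l - x) / y.
have F' : derive1 F = cst y^-1.
  by apply/funext => l; rewrite derive1E; have dF := is_derive_scale x y l; exact: derive_val.
rewrite [RHS](@increasing_ge0_integration_by_substitutionT _ F).
- by apply: eq_integral => l _; rewrite poissonE ?gt_eqF// F'.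
- by move=> a b ab; rewrite /F ltr_pM2r ?invr_gt0// ltrD2r.
- by rewrite F' => l; exact: cst_continuous.
- by rewrite F'; exact: is_cvg_cst.
- by rewrite F'; exact: is_cvg_cst.
- by move=> l; have dF := is_derive_scale x y l; exact: ex_derive.
- apply/cvgrNyPle => M; near=> l; rewrite /F ler_pdivrMr// lerBlDr.
  by near: l; apply: nbhs_ninfty_le; exact: num_real.
- apply/cvgryPge => M; near=> l; rewrite /F ler_pdivlMr// lerBrDr.
  by near: l; apply: nbhs_pinfty_ge; exact: num_real.
- exact: continuous_oneDsqrV.
- by move=> l; rewrite invr_ge0.
Unshelve. all: by end_near. Qed.

Lemma is_derive_atan_scale x y l : 0 < y ->
  is_derive x 1 (fun x => atan ((x - l) / y)) (poisson l y x).
Proof.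
move=> y0; rewrite poissonE ?gt_eqF//; have dS := is_derive_scale l y x.
rewrite -[X in is_derive _ _ X _]/(@atan R \o (fun x => (x - l) / y)).
by apply: is_derive_eq; rewrite /oneDsqr mulrC.
Qed.

Lemma continuous_atan_scale y l : 0 < y ->
  continuous (fun x => atan ((x - l) / y)).
Proof.
move=> y0 x; apply/differentiable_continuous/derivable1_diffP.
by have := is_derive_atan_scale x l y0 => dF; exact: ex_derive.
Qed.

Lemma continuous_poisson x y : 0 < y -> continuous (poisson x y).
Proof.
move=> y0 l.
rewrite (_ : poisson x y = fun l => (oneDsqr ((l - x) / y))^-1 * y^-1); last first.
  by apply/funext => t; rewrite poissonE ?gt_eqF.
apply: cvgM; last exact: cvg_cst.
apply: (@continuous_comp _ _ _ (fun l => (l - x) / y) (fun t => (oneDsqr t)^-1)).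
  apply: cvgM; last exact: cvg_cst.
  by apply: cvgB; [exact: cvg_id|exact: cvg_cst].
exact: continuous_oneDsqrV.
Qed.

Lemma integral_itv_poisson a b y l : a < b -> 0 < y ->
  (\int[lebesgue_measure]_(x in `[a, b]) (poisson x y l)%:E =
   (atan ((b - l) / y) - atan ((a - l) / y))%:E)%E.
Proof.
move=> ab y0.
under eq_integral do rewrite poissonC.
rewrite (@continuous_FTC2 _ _ (fun x => atan ((x - l) / y)))//.
- by apply: continuous_subspaceT; exact: continuous_poisson.
- split=> [x _|  |].
  + by have dF := is_derive_atan_scale x l y0; exact: ex_derive.
  + by apply: cvg_at_right_filter; exact: continuous_atan_scale.
  + by apply: cvg_at_left_filter; exact: continuous_atan_scale.
- move=> x _; rewrite derive1E; have dF := is_derive_atan_scale x l y0.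
  exact: derive_val.
Qed.

End poisson.

(** * Stieltjes inversion *)

Section stieltjes_inversion.
Context {R : realType}.
Implicit Types (mu : {measure set (measurableTypeR R) -> \bar R}) (a b x y l : R).

Local Notation leb := (@lebesgue_measure R).

Definition herglotz_finite mu :=
  (\int[mu]_l ((1 + (l : R) ^+ 2)^-1)%:E < +oo)%E.

Lemma measurable_weight :
  measurable_fun [set: measurableTypeR R] (fun l : R => ((1 + l ^+ 2)^-1)%:E).
Proof.
apply/measurable_EFinP; apply: (@continuous_measurable_fun R).
exact: continuous_oneDsqrV.
Qed.

Lemma weight_gt0 l : 0 < (1 + l ^+ 2)^-1.
Proof. by rewrite invr_gt0 ltr_pwDl ?sqr_ge0. Qed.

Lemma integrable_weight mu : herglotz_finite mu ->
  mu.-integrable setT (fun l : R => ((1 + l ^+ 2)^-1)%:E).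
Proof.
move=> fmu; apply/integrableP; split; first exact: measurable_weight.
apply: le_lt_trans fmu; rewrite le_eqVlt; apply/orP; left; apply/eqP.
by apply: eq_integral => l _; rewrite gee0_abs// lee_fin ltW ?weight_gt0.
Qed.

Lemma le_herglotz_bounded mu (M : R) :
  (mu `[(- M)%R, M]%classic <=
   (1 + M ^+ 2)%:E * \int[mu]_l ((1 + (l : R) ^+ 2)^-1)%:E)%E.
Proof.
have M0 : 0 < 1 + M ^+ 2 by rewrite ltr_pwDl ?sqr_ge0.
have w0 l : setT l -> (0 <= ((1 + l ^+ 2)^-1)%:E)%E.
  by move=> _; rewrite lee_fin ltW ?weight_gt0.
have M0' : (0%:E <= (1 + M ^+ 2)%:E)%E by rewrite lee_fin ltW.
rewrite -(ge0_integralZl mu measurableT measurable_weight w0 M0').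
set I := `[- M, M]%classic : set (measurableTypeR R).
have mI : measurable I by exact: measurable_itv.
have -> : mu I = (\int[mu]_l (\1_I l)%:E)%E.
  by rewrite integral_indic ?setIT.
apply: ge0_le_integral => //=.
- by apply/measurable_EFinP/measurable_indic.
- by apply: emeasurable_funM => //; exact: measurable_weight.
- move=> l _; rewrite -EFinM lee_fin indicE /I mem_setE in_itv/=.
  have [/andP[lM Ml]|_] := boolP (- M <= l <= M); last first.
    by rewrite mulr_ge0// ltW// weight_gt0.
  rewrite ler_pdivlMr ?mul1r ?ltr_pwDl ?sqr_ge0// lerD2l.
  by rewrite -(real_normK (num_real l)) ler_pXn2r ?nnegrE ?ler_norml ?lM//; lra.
Qed.

Lemma herglotz_bounded_fin mu (M : R) : herglotz_finite mu ->
  (mu `[(- M)%R, M]%classic < +oo)%E.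
Proof.
move=> fmu; apply: le_lt_trans (le_herglotz_bounded mu M) _.
rewrite lte_mul_pinfty//; first by rewrite lee_fin addr_ge0 ?sqr_ge0.
Qed.

Lemma herglotz_sigma_finite mu : herglotz_finite mu -> sigma_finite setT mu.
Proof.
move=> fmu; exists (fun n => `[- n%:R, n%:R]%classic).
  apply/esym; rewrite -subTset => l _.
  exists (Num.truncn `|l|).+1 => //=; rewrite in_itv/= -ler_norml.
  by rewrite ltW// truncnS_gt.
by move=> n; split => //; exact: herglotz_bounded_fin.
Qed.

Lemma integral_poisson_itv mu a b y : herglotz_finite mu -> 0 < y -> a < b ->
  (\int[leb]_(x in `[a, b]%classic) (\int[mu]_l (poisson x y l)%:E) =
   \int[mu]_l (atan ((b - l) / y) - atan ((a - l) / y))%:E)%E.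
Proof.
move=> fmu y0 ab.
pose sfin := isSFinite.Build _ _ _ _
  (sfinite_measure_sigma_finite (herglotz_sigma_finite fmu)).
pose mu' := HB.pack_for (SFiniteMeasure.type (measurableTypeR R) R)
  (Measure.sort mu) sfin.
pose f (xl : measurableTypeR R * measurableTypeR R) : \bar R :=
  ((poisson xl.1 y xl.2)%:E * (\1_`[a, b] xl.1)%:E)%E.
have f0 xl : (0 <= f xl)%E.
  by rewrite mule_ge0 ?lee_fin ?poisson_ge0// ltW.
have mp : measurable_fun setT
    (fun xl : measurableTypeR R * measurableTypeR R => poisson xl.1 y xl.2).
  by apply: measurable_poisson; [exact: measurable_fst|exact: measurable_cst|exact: measurable_snd].
have mf : measurable_fun setT f.
  apply: emeasurable_funM; first exact/measurable_EFinP.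
  apply/measurable_EFinP; apply: measurableT_comp; last exact: measurable_fst.
  exact: measurable_indic.
have mpx x : measurable_fun setT (fun l : measurableTypeR R => (poisson x y l)%:E).
  by apply/measurable_EFinP; apply: measurable_poisson => //; exact: measurable_cst.
have mpl l : measurable_fun setT (fun x : measurableTypeR R => (poisson x y l)%:E).
  by apply/measurable_EFinP; apply: measurable_poisson => //; exact: measurable_cst.
have := @sfinite_Fubini _ _ _ _ R leb mu' f f0 mf.
have -> : (\int[leb]_x \int[mu']_l f (x, l) =
    \int[leb]_(x in `[a, b]%classic) (\int[mu]_l (poisson x y l)%:E))%E.
  rewrite [RHS]integral_mkcond; apply: eq_integral => x _.
  rewrite /f /= patchE; under eq_integral do rewrite muleC.
  rewrite ge0_integralZl//; last by move=> l _; rewrite lee_fin poisson_ge0// ltW.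
  by rewrite indicE; case: ifP; rewrite ?mul1e ?mul0e.
move=> ->; apply: eq_integral => l _.
rewrite -integral_itv_poisson// [RHS]integral_mkcond.
apply: eq_integral => x _; rewrite /f /= patchE indicE.
by case: ifP; rewrite ?mule1 ?mule0.
Qed.

(** The shift [s = n.+1^-1] is large compared with the height [s ^+ 2].  Hence the
value at [t = 0] is [pi / 2] and not [0]: this is what makes the inversion
formula select a half-open interval, without the usual half masses at the
end points. *)
Lemma cvg_atan_inversion (t : R) :
  (fun n => atan ((t + n.+1%:R^-1) / n.+1%:R^-1 ^+ 2)) @ \oo -->
  (if 0 <= t then pi / 2 else - (pi / 2)).
Proof.
have argE n : (t + n.+1%:R^-1) / n.+1%:R^-1 ^+ 2 =
    n.+1%:R * (t * n.+1%:R + 1) :> R.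
  have n0 : n.+1%:R != 0 :> R by rewrite pnatr_eq0.
  set N : R := n.+1%:R in n0 *; by field.
under eq_fun do rewrite argE.
have nyy M : \forall n \near \oo, M <= n.+1%:R :> R.
  near=> n; apply: (@le_trans _ _ n%:R); last by rewrite ler_nat.
  by near: n; exact: nbhs_infty_ger.
case: ifPn => t0.
  apply: (cvg_comp _ (@atan R) _ (@cvgy_atan R)).
  apply/cvgryPge => M; near=> n.
  apply: (@le_trans _ _ n.+1%:R); first by near: n; exact: nyy.
  by rewrite ler_peMr// lerDr mulr_ge0.
rewrite -ltNge in t0.
under eq_fun do rewrite -[n in atan n]opprK atanN; apply: cvgN.
apply: (cvg_comp _ (@atan R) _ (@cvgy_atan R)).
apply/cvgryPge => M; near=> n.
apply: (@le_trans _ _ n.+1%:R); first by near: n; exact: nyy.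
have : 2 / (- t) <= n.+1%:R by near: n; exact: nyy.
by rewrite ler_pdivrMr ?oppr_gt0// -mulrN => h; rewrite ler_peMr//; lra.
Unshelve. all: by end_near. Qed.

(** Far from the interval the kernel decays quadratically, and near it the
difference of arctangents is at most [pi]. *)
Lemma atan_diff_le (A : R) a b y l : 0 < y -> y <= 1 -> a < b -> 1 <= A ->
  - A <= a -> b <= A ->
  `|atan ((b - l) / y) - atan ((a - l) / y)| <=
    (pi * (1 + 4 * A ^+ 2) + 8 * (b - a)) * (1 + l ^+ 2)^-1.
Proof.
move=> y0 y1 ab A1 Aa bA.
have l0 : 0 < 1 + l ^+ 2 by rewrite ltr_pwDl ?sqr_ge0.
have pi0 : 0 <= pi :> R by exact: pi_ge0.
rewrite ler_pdivlMr// ger0_norm; last first.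
  by rewrite subr_ge0; apply: le_atan; rewrite ler_pM2r ?invr_gt0// lerB// ltW.
have [lA|lA] := lerP `|l| (2 * A).
  have : atan ((b - l) / y) - atan ((a - l) / y) <= pi.
    have := atan_ltpi2 ((b - l) / y); have := atan_gtNpi2 ((a - l) / y); lra.
  move=> /(ler_wpM2r (ltW l0)) h; apply: le_trans h _.
  have : `|l| ^+ 2 <= (2 * A) ^+ 2 by rewrite ler_pXn2r ?nnegrE//; lra.
  rewrite real_normK ?num_real// => h2.
  have : pi * (1 + l ^+ 2) <= pi * (1 + 4 * A ^+ 2) by rewrite ler_wpM2l//; lra.
  have : 0 <= 8 * (b - a) by lra.
  lra.
(* By the mean value theorem, the difference is a value of the kernel times
   the length of the interval. *)
have [c cab ->] : exists2 c, c \in `]a, b[ &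
    atan ((b - l) / y) - atan ((a - l) / y) = poisson l y c * (b - a).
  apply: (@MVT _ (fun x => atan ((x - l) / y)) (poisson l y)) => //.
    by move=> x _; exact: is_derive_atan_scale.
  by apply: continuous_subspaceT; exact: continuous_atan_scale.
move: cab; rewrite in_itv/= => /andP[ac cb].
rewrite /poisson mulrAC.
have lc : 1 + l ^+ 2 <= 8 * (c - l) ^+ 2.
  have [l00|l00] := lerP 0 l; [rewrite ger0_norm// in lA|rewrite ltr0_norm// in lA]; nra.
have d0 := poisson_den_gt0 l c y0.
have : y * (1 + l ^+ 2) / ((c - l) ^+ 2 + y ^+ 2) <= 8.
  rewrite ler_pdivrMr//; apply: (@le_trans _ _ (1 + l ^+ 2)).
    by rewrite ler_piMl// ltW.
  have := sqr_ge0 y; lra.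
move=> h8; have : y * (1 + l ^+ 2) / ((c - l) ^+ 2 + y ^+ 2) * (b - a) <= 8 * (b - a).
  by rewrite ler_pM2r// subr_gt0.
have : 0 <= pi * (1 + 4 * A ^+ 2) by rewrite mulr_ge0// addr_ge0// mulr_ge0 ?sqr_ge0.
by rewrite mulrAC; lra.
Qed.

Lemma atan_diff_le_unif a b : a < b -> exists2 C : R, 0 <= C & forall n l,
  `|atan ((b + n.+1%:R^-1 - l) / n.+1%:R^-1 ^+ 2) -
    atan ((a + n.+1%:R^-1 - l) / n.+1%:R^-1 ^+ 2)| <= C * (1 + l ^+ 2)^-1.
Proof.
move=> ab; pose A := 2 + `|a| + `|b|.
exists (pi * (1 + 4 * A ^+ 2) + 8 * (b - a)).
  rewrite addr_ge0//; last by rewrite mulr_ge0// subr_ge0 ltW.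
  by rewrite mulr_ge0 ?pi_ge0// addr_ge0// mulr_ge0 ?sqr_ge0.
move=> n l.
have s0 : 0 < n.+1%:R^-1 :> R by rewrite invr_gt0.
have s1 : n.+1%:R^-1 <= 1 :> R by rewrite invf_le1// ler1n.
have -> : b - a = b + n.+1%:R^-1 - (a + n.+1%:R^-1) by ring.
have := ler_norm b; have := ler_norm (- a); rewrite normrN => aa bb.
have := normr_ge0 a; have := normr_ge0 b => a0 b0.
apply: atan_diff_le; rewrite ?exprn_gt0 ?exprn_ile1 ?ltrD2r ?(ltW s0)//;
  rewrite /A; move: (n.+1%:R^-1) `|a| `|b| s0 s1 a0 b0 aa bb => s na nb; lra.
Qed.

Lemma measurable_atan_diff a b y :
  measurable_fun [set: measurableTypeR R]
    (fun l : R => (atan ((b - l) / y) - atan ((a - l) / y))%:E).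
Proof.
have matan (c : R) : measurable_fun [set: measurableTypeR R]
    (fun l : R => atan ((c - l) / y)).
  apply: (measurableT_comp (f := @atan R)).
    by apply: (@continuous_measurable_fun R) => l; exact: continuous_atan.
  by apply: measurable_funM => //; exact: measurable_funB.
by apply/measurable_EFinP; apply: measurable_funB; exact: matan.
Qed.

(** After the order of integration is exchanged, the integrand is a difference
of arctangents that tends to [pi] times the indicator function of [`]a, b]]. *)
Lemma stieltjes_inversion mu a b : herglotz_finite mu -> a < b ->
  (\int[leb]_(x in `[(a + n.+1%:R^-1)%R, (b + n.+1%:R^-1)%R]%classic)
     (\int[mu]_l (poisson x (n.+1%:R^-1 ^+ 2) l)%:E))%E @[n --> \oo] -->
  (pi%:E * mu `]a, b]%classic)%E.
Proof.
move=> fmu ab.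
have s0 n : 0 < n.+1%:R^-1 :> R by rewrite invr_gt0.
pose F n l : R := atan ((b + n.+1%:R^-1 - l) / n.+1%:R^-1 ^+ 2) -
  atan ((a + n.+1%:R^-1 - l) / n.+1%:R^-1 ^+ 2).
under eq_fun do rewrite integral_poisson_itv ?exprn_gt0 ?ltrD2r//.
set I := `]a, b]%classic : set (measurableTypeR R).
have mI : measurable I by exact: measurable_itv.
have -> : (pi%:E * mu I)%E = (\int[mu]_l (pi * \1_I l)%:E)%E.
  under eq_integral do rewrite EFinM.
  rewrite ge0_integralZl ?lee_fin ?pi_ge0//.
    by rewrite integral_indic ?setIT.
  by apply/measurable_EFinP/measurable_indic.
have [C _ FC] := atan_diff_le_unif ab.
have [] // := @dominated_convergence _ _ _ mu setT measurableT
  (fun n l => (F n l)%:E) (fun l => (pi * \1_I l)%:E)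
  (fun l : R => (C%:E * ((1 + l ^+ 2)^-1)%:E)%E).
- by move=> n; exact: measurable_atan_diff.
- by apply/measurable_EFinP; apply: measurable_funM.
- apply: aeW => l _; apply: cvg_EFin; first exact: nearW.
  rewrite /comp /= /F.
  under eq_fun do rewrite !(addrAC _ _ (- l)).
  have -> : (pi * \1_I l : R) =
      (if 0 <= b - l then pi / 2 else - (pi / 2)) -
      (if 0 <= a - l then pi / 2 else - (pi / 2)) :> R.
    rewrite !subr_ge0 indicE /I mem_setE in_itv/=.
    have [la|al] := leP l a; have [lb|bl] := leP l b => /=.
    + by rewrite subrr mulr0.
    + lra.
    + by rewrite mulr1 opprK -splitr.
    + by rewrite subrr mulr0.
  apply: cvgB; exact: cvg_atan_inversion.
- exact: integrableZl (integrable_weight fmu).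
- by apply: aeW => l n _; rewrite -EFinM abse_EFin lee_fin; exact: FC.
Qed.

End stieltjes_inversion.

(** * Measurable families of measures on the line *)

Section measure_families.
Context {R : realType}.

(** A monotone class argument inside each [`]-n, n]], where the measures are
finite, so that complements are handled by subtraction. *)
Lemma measurable_family d (T : measurableType d)
    (mu : T -> {measure set (measurableTypeR R) -> \bar R}) :
  (forall t n, (mu t `](- n%:R)%R, n%:R%R]%classic < +oo)%E) ->
  (forall a b : R, a < b ->
     measurable_fun setT (fun t => mu t `]a, b]%classic)) ->
  forall A : set (measurableTypeR R), measurable A ->
  measurable_fun setT (fun t => mu t A).
Proof.
move=> fmu mmu.
pose I n : set (measurableTypeR R) := `](- n%:R), n%:R]%classic.
have mI n : measurable (I n) by exact: measurable_itv.
have moc X : ocitv X -> measurable_fun setT (fun t => mu t X).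
  move=> /ocitvP[->|[[a b] /= ab ->]]; last exact: mmu.
  by under eq_fun do rewrite measure0; exact: measurable_cst.
have mAI n (A : set (measurableTypeR R)) : measurable A ->
    measurable_fun setT (fun t => mu t (A `&` I n)).
  apply: (@dynkin_induction _ (measurableTypeR R) (@ocitv R)
    (fun A => measurable_fun setT (fun t => mu t (A `&` I n)))) => //.
  - exact: ocitvI.
  - by rewrite setTI; apply: moc; exact: is_ocitv.
  - by move=> X oX; apply: moc; apply: ocitvI => //; exact: is_ocitv.
  - move=> S mS mSI.
    rewrite (_ : (fun t => _) = (fun t => mu t (I n) - mu t (S `&` I n))%E).
      by apply: emeasurable_funB => //; apply: moc; exact: is_ocitv.
    apply/funext => t.
    by rewrite setIC -setDE measureD// ?fmu// [I n `&` S]setIC.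
  - move=> F mF tF mFI.
    rewrite (_ : (fun t => _) =
        (fun t => \sum_(0 <= k <oo) mu t (F k `&` I n))%E); last first.
      apply/funext => t; rewrite setI_bigcupl measure_semi_bigcup//.
      + by move=> i; exact: measurableI.
      + exact: trivIset_setIr.
      + by apply: bigcupT_measurable => i; exact: measurableI.
    exact: ge0_emeasurable_sum.
move=> A mA.
apply: (emeasurable_fun_cvg (fun n t => mu t (A `&` I n))).
  by move=> n; exact: mAI.
move=> t _.
have AE : A = \bigcup_n (A `&` I n).
  rewrite -setI_bigcupr; apply/esym/setIidl => x _.
  exists (Num.truncn `|x|).+1 => //; rewrite /I /= in_itv/=.
  have : `|x| < (Num.truncn `|x|).+1%:R by exact: truncnS_gt.
  by rewrite ltr_norml => /andP[-> /ltW].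
rewrite {2}AE.
apply: (nondecreasing_cvg_mu (mu := mu t)).
- by move=> i; exact: measurableI.
- by rewrite -AE.
- move=> m n mn; apply/subsetPset; apply: setIS; apply: subset_itv;
  by rewrite bnd_simp ?lerN2 ler_nat.
Qed.

(** The left-hand side is a measure in [A], and the half-open intervals
characterize Lebesgue measure. *)
Lemma integral_measure_family_lebesgue
    (mu : R -> {measure set (measurableTypeR R) -> \bar R}) :
  (forall A : set (measurableTypeR R), measurable A ->
     measurable_fun [set: measurableTypeR R] (fun r => mu r A)) ->
  (forall a b : R, a < b ->
     (\int[lebesgue_measure]_r mu r `]a, b]%classic = (b - a)%:E)%E) ->
  forall A : set (measurableTypeR R), measurable A ->
  (\int[lebesgue_measure]_r mu r A = lebesgue_measure A)%E.
Proof.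
move=> mmu intmu A mA; apply/esym.
pose nu (B : set (measurableTypeR R)) := (\int[lebesgue_measure]_r mu r B)%E.
have nu0 : nu set0 = 0%E.
  by rewrite /nu; under eq_integral do rewrite measure0; rewrite integral0.
have nu_ge0 B : (0 <= nu B)%E by exact: integral_ge0.
have nu_additive : semi_sigma_additive nu.
  move=> F mF tF mUF; rewrite /nu.
  have -> : (\int[lebesgue_measure]_r mu r (\bigcup_n F n) =
      \sum_(0 <= n <oo) nu (F n))%E.
    rewrite -integral_nneseries//; last by move=> n; exact: mmu.
    by apply: eq_integral => r _; rewrite measure_semi_bigcup.
  by apply: is_cvg_nneseries => n _ _; exact: nu_ge0.
pose nuM := isMeasure.Build _ _ _ nu nu0 nu_ge0 nu_additive.
pose nu' := HB.pack_for {measure set (measurableTypeR R) -> \bar R} nu nuM.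
rewrite (@lebesgue_measure_unique R nu')// => X /ocitvP[->|[[a b] /= ab ->]].
  by rewrite !measure0.
by rewrite lebesgue_measure_itv/= lte_fin ab /nu intmu.
Qed.

End measure_families.

Local Open Scope complex_scope.

(** * Herglotz functions and their Poisson integrals *)

Lemma derivable_inv_subr (K : numFieldType) (h : K -> K) (c z : K) :
  c - h z != 0 -> derivable (h : K^o -> K^o) z 1 ->
  derivable ((fun z => (c - h z)^-1) : K^o -> K^o) z 1.
Proof.
move=> chz dh; apply: (@derivableV K K^o (fun z => c - h z)) => //.
by apply: (@derivableB K K^o K^o (cst c)) => //; exact: derivable_cst.
Qed.

Lemma derivable_dist_lt (K : numFieldType) (h : K -> K) (z e : K) :
  derivable (h : K^o -> K^o) z 1 -> 0 < e ->
  exists2 d : K, 0 < d & forall w, `|z - w| < d -> `|h z - h w| < e.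
Proof.
move=> dh e0.
have : {for z, continuous (h : K^o -> K^o)}.
  exact/differentiable_continuous/derivable1_diffP.
move=> /cvgrPdist_lt/(_ _ e0) /nbhs_ballP[d d0 dP].
by exists d => // w zw; exact: dP.
Qed.

Section herglotz_poisson.
Context {R : realType}.

Lemma ImB (v w : R[i]) : complex.Im (v - w) = complex.Im v - complex.Im w.
Proof. by case: v w => ? ? [? ?]. Qed.

Lemma ImD (v w : R[i]) : complex.Im (v + w) = complex.Im v + complex.Im w.
Proof. by case: v w => ? ? [? ?]. Qed.

Lemma ReB (v w : R[i]) : complex.Re (v - w) = complex.Re v - complex.Re w.
Proof. by case: v w => ? ? [? ?]. Qed.

Lemma Im_invC (w : R[i]) :
  complex.Im w^-1 = - complex.Im w / (complex.Re w ^+ 2 + complex.Im w ^+ 2).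
Proof. by case: w => a b; rewrite mulNr. Qed.

Lemma Im_herglotz_family (h : R[i] -> R[i]) r z :
  complex.Im (herglotz_family h r z) =
  poisson (complex.Re (h z)) (complex.Im (h z)) r.
Proof.
by rewrite /herglotz_family Im_invC ImB ReB /= sub0r opprK sqrrN.
Qed.

Lemma Im_herglotz_kernel (x y l : R) :
  complex.Im ((l%:C - (x +i* y))^-1 - (l / (l ^+ 2 + 1))%:C) = poisson x y l.
Proof.
rewrite ImB Im_invC ReB ImB /= subr0.
by rewrite sub0r opprK sqrrN.
Qed.

Lemma herglotz_family_herglotz (h : R[i] -> R[i]) r :
  herglotz h -> herglotz (herglotz_family h r).
Proof.
move=> hh z zH; have [dh hzH] := hh z zH.
have rhz : r%:C - h z != 0.
  apply/eqP => /(congr1 (@complex.Im R)); rewrite ImB/= sub0r.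
  by move/eqP; rewrite oppr_eq0 => /eqP im0; move: hzH; rewrite /upper_half_plane /= im0 ltxx.
split; last first.
  by rewrite /upper_half_plane/= Im_herglotz_family divr_gt0// poisson_den_gt0.
rewrite /herglotz_family.
exact: derivable_inv_subr rhz dh.
Qed.

(** The imaginary part of the representation formula, in which the compensating
term [l / (l ^+ 2 + 1)] disappears. *)
Lemma integral_poisson_herglotz f alpha beta mu (x y : R) :
  herglotz_representation f alpha beta mu -> 0 < y ->
  (\int[mu]_l (poisson x y l)%:E =
   (complex.Im (f (x +i* y)) - alpha * y)%:E)%E.
Proof.
move=> [alpha0 fmu fE] y0.
rewrite (fE (x +i* y)); last by rewrite /upper_half_plane.
have ImZ : complex.Im (alpha%:C * (x +i* y)) = alpha * y by rewrite /= mul0r addr0.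
have Imr : complex.Im beta%:C = 0 by [].
have ImI f0 : complex.Im (complex_integral mu f0) =
    Rintegral mu setT (fun l => complex.Im (f0 l)) by [].
rewrite !ImD ImZ Imr ImI addr0 [(alpha * y + _)%R]addrC addrK.
under eq_Rintegral do rewrite Im_herglotz_kernel.
rewrite /Rintegral fineK//.
have mp : measurable_fun setT (fun l : measurableTypeR R => (poisson x y l)%:E).
  by apply/measurable_EFinP; apply: measurable_poisson => //; exact: measurable_cst.
rewrite ge0_fin_numE; last by apply: integral_ge0 => l _; rewrite lee_fin poisson_ge0// ltW.
pose C := y * (2 + (1 + 2 * x ^+ 2) / y ^+ 2).
have C0 : 0 <= C.
  by rewrite mulr_ge0 ?(ltW y0)// addr_ge0// divr_ge0 ?sqr_ge0// addr_ge0// mulr_ge0// sqr_ge0.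
apply: (@le_lt_trans _ _ (\int[mu]_l (C%:E * ((1 + (l : R) ^+ 2)^-1)%:E))%E).
  apply: ge0_le_integral => //.
  - by move=> l _; rewrite lee_fin poisson_ge0// ltW.
  - by apply: emeasurable_funM => //; exact: measurable_weight.
  - by move=> l _; rewrite -EFinM lee_fin poisson_le.
rewrite ge0_integralZl//.
- by rewrite lte_mul_pinfty.
- exact: measurable_weight.
- by move=> l _; rewrite lee_fin ltW// weight_gt0.
Qed.

Lemma normc_ge_Im (w : R[i]) : (`|complex.Im w|)%:C <= `|w|.
Proof.
by rewrite normc_def lecR -sqrtr_sqr ler_wsqrtr// lerDr sqr_ge0.
Qed.

Lemma herglotz_continuous h z : herglotz h -> upper_half_plane z ->
  forall e : R, 0 < e -> exists2 d : R, 0 < d &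
    forall w, `|z - w| < d%:C -> `|h z - h w| < e%:C.
Proof.
move=> hh zH e e0; have [dh _] := hh z zH.
have ec0 : 0 < e%:C :> R[i] by rewrite ltcR.
have [d d0 dP] := derivable_dist_lt dh ec0.
have dE : d = (complex.Re d)%:C.
  by move: d0; case: (d) => a b; rewrite ltcE/= => /andP[/eqP -> _].
exists (complex.Re d); first by move: d0; rewrite dE ltcR.
by rewrite -dE => w zw; exact: dP.
Qed.

Lemma herglotz_continuous_line h (y : R) : herglotz h -> 0 < y ->
  continuous (fun x : R => complex.Re (h (x +i* y))) /\
  continuous (fun x : R => complex.Im (h (x +i* y))).
Proof.
move=> hh y0.
have H x (e : R) : 0 < e -> \forall t \near x, `|h (x +i* y) - h (t +i* y)| < e%:C.
  move=> e0; have [//|d d0 dP] := herglotz_continuous hh (_ : upper_half_plane (x +i* y)) e0.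
  apply/nbhs_ballP; exists d => //= t xt; apply: dP.
  have -> : x +i* y - (t +i* y) = (x - t)%:C.
    by apply/eqP; rewrite eq_complex/= subrr !eqxx.
  by rewrite normc_def/= expr0n addr0 sqrtr_sqr ltcR.
split=> x; apply/cvgrPdist_lt => e e0; have := H x e e0; apply: filterS => t.
  by rewrite -ReB -ltcR; apply: le_lt_trans; exact: normc_ge_Re.
by rewrite -ImB -ltcR; apply: le_lt_trans; exact: normc_ge_Im.
Qed.

Lemma measurable_Re_herglotz h (y : R) : herglotz h -> 0 < y ->
  measurable_fun [set: measurableTypeR R] (fun x : R => complex.Re (h (x +i* y))).
Proof.
move=> hh y0; apply: (@continuous_measurable_fun R).
exact: (herglotz_continuous_line hh y0).1.
Qed.

Lemma measurable_Im_herglotz h (y : R) : herglotz h -> 0 < y ->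
  measurable_fun [set: measurableTypeR R] (fun x : R => complex.Im (h (x +i* y))).
Proof.
move=> hh y0; apply: (@continuous_measurable_fun R).
exact: (herglotz_continuous_line hh y0).2.
Qed.

End herglotz_poisson.

(** * The average of the measures of the family *)

Section herglotz_average.
Context {R : realType} (h : R[i] -> R[i]).
Context (hh : herglotz h).
Context (mu : R -> {measure set (measurableTypeR R) -> \bar R}).
Context (hmu : forall r : R, measure_of_herglotz (herglotz_family h r) (mu r)).

Local Notation leb := (@lebesgue_measure R).
Local Notation u x y := (complex.Re (h (x +i* y))).
Local Notation v x y := (complex.Im (h (x +i* y))).

(** The coefficient [alpha] in the representation of the function of parameter
[r]. *)
Definition linear_coef (r : R) : R := sval (cid (hmu r)).

Local Notation al := linear_coef.

Lemma linear_coefP r : exists beta,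
  herglotz_representation (herglotz_family h r) (al r) beta (mu r).
Proof. exact: svalP (cid (hmu r)). Qed.

Lemma linear_coef_ge0 r : 0 <= al r.
Proof. by have [beta []] := linear_coefP r. Qed.

Lemma herglotz_finite_mu r : herglotz_finite (mu r).
Proof. by have [beta []] := linear_coefP r. Qed.

Lemma Im_herglotz_gt0 (x y : R) : 0 < y -> 0 < v x y.
Proof. by move=> y0; have [] := hh (_ : upper_half_plane (x +i* y)). Qed.

Lemma integral_poisson_family r (x y : R) : 0 < y ->
  (\int[mu r]_l (poisson x y l)%:E = (poisson (u x y) (v x y) r - al r * y)%:E)%E.
Proof.
move=> y0; have [beta rep] := linear_coefP r.
by rewrite (integral_poisson_herglotz x rep y0) Im_herglotz_family.
Qed.

Lemma linear_coef_le r (x y : R) : 0 < y ->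
  al r * y <= poisson (u x y) (v x y) r.
Proof.
move=> y0; rewrite -subr_ge0 -lee_fin -integral_poisson_family//.
by apply: integral_ge0 => l _; rewrite lee_fin poisson_ge0// ltW.
Qed.

(** If [al r] is positive, then [(r - h (i y))^-1] grows at least like [y], so
that [h (i y)] is within a multiple of [y^-1] of [r].  For large [y] this can
be true of a single [r]. *)
Lemma linear_coef_unique (r1 r2 : R) : 0 < al r1 -> 0 < al r2 -> r1 = r2.
Proof.
move=> a1 a2; apply/eqP/negPn/negP => r12.
pose m := Num.min (al r1) (al r2).
have m0 : 0 < m by rewrite /m lt_min a1 a2.
have r0 : 0 < `|r1 - r2| by rewrite normr_gt0 subr_eq0.
pose y := 2 / (m * `|r1 - r2|).
have y0 : 0 < y by rewrite divr_gt0// mulr_gt0.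
have H r : m <= al r -> 2 * `|r - u 0 y| * (m * y) <= 1.
  move=> mr; have := poisson_le_dist (u 0 y) r (Im_herglotz_gt0 0 y0).
  apply: le_trans; apply: ler_wpM2l; first by rewrite mulr_ge0.
  by apply: le_trans (linear_coef_le r 0 y0); rewrite ler_pM2r.
have H1 : 2 * `|r1 - u 0 y| * (m * y) <= 1 by apply: H; rewrite /m ge_min lexx.
have H2 : 2 * `|r2 - u 0 y| * (m * y) <= 1 by apply: H; rewrite /m ge_min lexx orbT.
have : `|r1 - r2| <= `|r1 - u 0 y| + `|r2 - u 0 y|.
  by rewrite (distrC r2); exact: ler_distD.
have myE : m * y * `|r1 - r2| = 2 by rewrite /y; field; rewrite !gt_eqF.
have my0 : 0 < m * y by rewrite mulr_gt0.
move=> /(ler_wpM2l (ltW my0)); rewrite myE; lra.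
Qed.

Lemma linear_coef_exceptional : exists r0, forall r, r != r0 -> al r = 0.
Proof.
have [[r0 ar0]|nr] := pselect (exists r0, 0 < al r0).
  exists r0 => r rr0; apply/eqP; move: rr0; apply: contraNT => ar.
  apply/eqP/linear_coef_unique => //.
  by rewrite lt_neqAle eq_sym ar linear_coef_ge0.
exists 0 => r _; apply/eqP; apply: contrapT => ar; apply: nr; exists r.
by rewrite lt_neqAle eq_sym linear_coef_ge0 andbT; exact/negP.
Qed.

Lemma measurable_linear_coef : measurable_fun [set: measurableTypeR R] al.
Proof.
have [r0 r0P] := linear_coef_exceptional.
rewrite (_ : al = (fun r => al r0 * \1_[set r0] r)).
  by apply: measurable_funM => //; exact: measurable_indic.
apply/funext => r; rewrite indicE.
have [->|rr0] := eqVneq r r0; first by rewrite mem_set// mulr1.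
by rewrite memNset ?mulr0 ?r0P// => /eqP; exact/negP.
Qed.

(** The Poisson integral of [mu r] over a horizontal segment. *)
Definition segment_integral (a b y r : R) : \bar R :=
  (\int[leb]_(x in `[a, b]%classic)
     (poisson (u x y) (v x y) r - al r * y)%:E)%E.

Lemma measurable_poisson_family (y : R) : 0 < y ->
  measurable_fun [set: measurableTypeR R * measurableTypeR R]
    (fun rx => poisson (u rx.2 y) (v rx.2 y) rx.1 - al rx.1 * y).
Proof.
move=> y0; apply: measurable_funB.
  apply: measurable_poisson.
  - by apply: (measurableT_comp (measurable_Re_herglotz hh y0)); exact: measurable_snd.
  - by apply: (measurableT_comp (measurable_Im_herglotz hh y0)); exact: measurable_snd.
  - exact: measurable_fst.
apply: measurable_funM => //.
by apply: (measurableT_comp measurable_linear_coef); exact: measurable_fst.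
Qed.

Let segment_kernel a b y (rx : measurableTypeR R * measurableTypeR R) : \bar R :=
  ((poisson (u rx.2 y) (v rx.2 y) rx.1 - al rx.1 * y)%:E *
   (\1_(`[a, b]%classic : set (measurableTypeR R)) rx.2)%:E)%E.

Let measurable_segment_kernel a b y : 0 < y -> measurable_fun setT (segment_kernel a b y).
Proof.
move=> y0; apply: emeasurable_funM.
  by apply/measurable_EFinP; exact: measurable_poisson_family.
apply/measurable_EFinP; apply: measurableT_comp; last exact: measurable_snd.
exact: measurable_indic.
Qed.

Let segment_kernel_ge0 a b y : 0 < y -> forall rx, (0 <= segment_kernel a b y rx)%E.
Proof.
move=> y0 rx; rewrite mule_ge0 ?lee_fin// subr_ge0.
exact: linear_coef_le.
Qed.

Let segment_integralE a b y r :
  segment_integral a b y r = (\int[leb]_x segment_kernel a b y (r, x))%E.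
Proof.
rewrite /segment_integral integral_mkcond; apply: eq_integral => x _.
by rewrite patchE /segment_kernel/= indicE; case: ifP; rewrite ?mule1 ?mule0.
Qed.

Lemma measurable_segment_integral a b y : 0 < y ->
  measurable_fun [set: measurableTypeR R] (segment_integral a b y).
Proof.
move=> y0; rewrite (_ : segment_integral _ _ _ =
    fubini_F leb (segment_kernel a b y)).
  apply: measurable_fun_fubini_tonelli_F.
    exact: measurable_segment_kernel.
  exact: segment_kernel_ge0.
by apply/funext => r; rewrite segment_integralE.
Qed.

(** As a function of [r], [poisson (u x y) (v x y) r] is again a Poisson kernel,
of total mass [pi] for every [h]: this is why the average of the measures does
not depend on [h]. *)
Lemma integral_segment_integral a b y : a < b -> 0 < y ->
  (\int[leb]_r segment_integral a b y r = (pi * (b - a))%:E)%E.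
Proof.
move=> ab y0; under eq_integral do rewrite segment_integralE.
rewrite (sfinite_Fubini leb leb (segment_kernel a b y))//; last 2 first.
- exact: segment_kernel_ge0.
- exact: measurable_segment_kernel.
have [r0 r0P] := linear_coef_exceptional.
transitivity (\int[leb]_x (pi%:E * (\1_(`[a, b]%classic : set (measurableTypeR R)) x)%:E))%E.
  apply: eq_integral => x _.
  rewrite -(integral_poisson (u x y) (Im_herglotz_gt0 x y0)) muleC -ge0_integralZl//; last 2 first.
  - by apply/measurable_EFinP; apply: measurable_poisson => //; exact: measurable_cst.
  - by move=> r _; rewrite lee_fin poisson_ge0// ltW// Im_herglotz_gt0.
  apply: ge0_ae_eq_integral => //.
  - by apply: measurableT_comp; [exact: measurable_segment_kernel|exact: measurable_pair2].
  - apply: emeasurable_funM => //.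
    by apply/measurable_EFinP; apply: measurable_poisson => //; exact: measurable_cst.
  - by move=> r _; exact: segment_kernel_ge0.
  - move=> r _; rewrite mule_ge0// lee_fin// poisson_ge0// ltW//.
    exact: Im_herglotz_gt0.
  - exists [set r0]; split=> //; first exact: lebesgue_measure_set1.
    move=> r /=; apply: contra_notP => /eqP rr0 _.
    by rewrite /segment_kernel /= r0P// mul0r subr0 muleC.
rewrite ge0_integralZl ?lee_fin ?pi_ge0//.
  have -> : (\int[leb]_x (\1_(`[a, b]%classic : set (measurableTypeR R)) x)%:E =
      leb `[a, b]%classic)%E by rewrite integral_indic ?setIT.
  by rewrite lebesgue_measure_itv/= lte_fin ab -EFinB -EFinM.
by apply/measurable_EFinP/measurable_indic.
Qed.

Lemma cvg_segment_integral a b r : a < b ->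
  segment_integral (a + n.+1%:R^-1) (b + n.+1%:R^-1) (n.+1%:R^-1 ^+ 2) r
    @[n --> \oo] --> (pi%:E * mu r `]a, b]%classic)%E.
Proof.
move=> ab; have := stieltjes_inversion (herglotz_finite_mu r) ab.
apply: cvg_trans; apply: near_eq_cvg; apply: nearW => n.
apply: eq_integral => x _.
by rewrite integral_poisson_family// exprn_gt0// invr_gt0.
Qed.

(** A bound that is uniform in [n] and integrable in [r]. *)
Lemma segment_integral_le a b : a < b -> exists2 C : R, 0 <= C & forall n r,
  (segment_integral (a + n.+1%:R^-1) (b + n.+1%:R^-1) (n.+1%:R^-1 ^+ 2) r <=
   C%:E * (poisson (u 0 1) (v 0 1) r)%:E)%E.
Proof.
move=> ab; have [C C0 Cle] := atan_diff_le_unif ab; exists C => // n r.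
have s0 : 0 < n.+1%:R^-1 ^+ 2 :> R by rewrite exprn_gt0// invr_gt0.
have -> : segment_integral (a + n.+1%:R^-1) (b + n.+1%:R^-1) (n.+1%:R^-1 ^+ 2) r =
  (\int[leb]_(x in `[(a + n.+1%:R^-1)%R, (b + n.+1%:R^-1)%R]%classic)
     (\int[mu r]_l (poisson x (n.+1%:R^-1 ^+ 2) l)%:E))%E.
  by apply: eq_integral => x _; rewrite integral_poisson_family.
rewrite integral_poisson_itv ?ltrD2r//; last exact: herglotz_finite_mu.
have mp : measurable_fun setT (fun l : measurableTypeR R => (poisson 0 1 l)%:E).
  by apply/measurable_EFinP; apply: measurable_poisson => //; exact: measurable_cst.
have p0 l : (0 <= (poisson 0 1 l)%:E)%E by rewrite lee_fin poisson_ge0.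
apply: (@le_trans _ _ (\int[mu r]_l (C%:E * (poisson 0 1 l)%:E))%E).
  apply: ge0_le_integral => //.
  - move=> l _; rewrite lee_fin subr_ge0; apply: le_atan.
    by rewrite ler_pM2r ?invr_gt0// lerB// lerD2r ltW.
  - exact: measurable_atan_diff.
  - by apply: emeasurable_funM.
  - move=> l _; rewrite -EFinM lee_fin poisson01.
    by apply: le_trans (Cle n l); exact: ler_norm.
rewrite ge0_integralZl//.
rewrite integral_poisson_family//; apply: lee_wpmul2l; rewrite ?lee_fin//.
by rewrite mulr1 gerBl linear_coef_ge0.
Qed.

Lemma measurable_mu_itv a b : a < b ->
  measurable_fun [set: measurableTypeR R] (fun r => mu r `]a, b]%classic).
Proof.
move=> ab; rewrite (_ : (fun r => _) =
    (fun r => pi^-1%:E * (pi%:E * mu r `]a, b]%classic))%E); last first.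
  by apply/funext => r; rewrite muleA -EFinM mulVf ?mul1e// gt_eqF// pi_gt0.
apply: emeasurable_funM => //.
apply: (emeasurable_fun_cvg (fun n r => segment_integral (a + n.+1%:R^-1)
  (b + n.+1%:R^-1) (n.+1%:R^-1 ^+ 2) r)).
  by move=> n; apply: measurable_segment_integral; rewrite exprn_gt0// invr_gt0.
by move=> r _; exact: cvg_segment_integral.
Qed.

Lemma measurable_mu (A : set (measurableTypeR R)) : measurable A ->
  measurable_fun [set: measurableTypeR R] (fun r => mu r A).
Proof.
apply: measurable_family => [r n|]; last exact: measurable_mu_itv.
apply: le_lt_trans (herglotz_bounded_fin n%:R (herglotz_finite_mu r)).
by apply: le_measure; rewrite ?inE//; exact: subset_itv_oc_cc.
Qed.

(** Dominated convergence in [r], in the inversion formula for [mu r]. *)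
Lemma integral_mu_itv a b : a < b ->
  (\int[leb]_r mu r `]a, b]%classic = (b - a)%:E)%E.
Proof.
move=> ab.
have s0 n : 0 < n.+1%:R^-1 ^+ 2 :> R by rewrite exprn_gt0// invr_gt0.
pose J n r := segment_integral (a + n.+1%:R^-1) (b + n.+1%:R^-1) (n.+1%:R^-1 ^+ 2) r.
have pinum : 0 < pi :> R by exact: pi_gt0.
suff : (\int[leb]_r (pi%:E * mu r `]a, b]%classic) = (pi * (b - a))%:E)%E.
  rewrite ge0_integralZl//; [|exact: measurable_mu_itv|by rewrite lee_fin ltW].
  move=> /(congr1 (fun z => pi^-1%:E * z)%E).
  by rewrite muleA -!EFinM mulrA mulVf ?gt_eqF// mul1e mul1r.
have [C C0 JC] := segment_integral_le ab.
have J0 n r : (0 <= J n r)%E.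
  by apply: integral_ge0 => x _; rewrite lee_fin subr_ge0 linear_coef_le.
have mp : measurable_fun setT
    (fun r : measurableTypeR R => (C%:E * (poisson (u 0 1) (v 0 1) r)%:E)%E).
  apply: emeasurable_funM => //; apply/measurable_EFinP.
  by apply: measurable_poisson => //; exact: measurable_cst.
have [] // := @dominated_convergence _ _ _ leb setT measurableT J
  (fun r => (pi%:E * mu r `]a, b]%classic)%E)
  (fun r => (C%:E * (poisson (u 0 1) (v 0 1) r)%:E)%E).
- by move=> n; exact: measurable_segment_integral.
- by apply: emeasurable_funM => //; exact: measurable_mu_itv.
- by apply: aeW => r _; exact: cvg_segment_integral.
- apply: integrableZl => //; apply/integrableP; split.
    apply/measurable_EFinP.
    by apply: measurable_poisson => //; exact: measurable_cst.
  have v0 := Im_herglotz_gt0 0 ltr01.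
  under eq_integral do rewrite gee0_abs ?lee_fin ?poisson_ge0 ?(ltW v0)//.
  by rewrite integral_poisson// ltry.
- by apply: aeW => r n _; rewrite gee0_abs// JC.
move=> _ _; rewrite [X in X @ _ --> _](_ : _ = cst (pi * (b - a))%:E).
  by move=> /cvg_lim <- //; rewrite lim_cst.
apply/funext => n /=; rewrite integral_segment_integral ?ltrD2r//.
by congr (pi * _)%:E; ring.
Qed.

Lemma integral_mu (A : set (measurableTypeR R)) : measurable A ->
  (\int[leb]_r mu r A = leb A)%E.
Proof.
apply: integral_measure_family_lebesgue; first exact: measurable_mu.
exact: integral_mu_itv.
Qed.

End herglotz_average.

(** * Sets defined by convergence along a sequence *)

Section cvg0_sets.
Context d (T : measurableType d) {R : realType}.

Lemma measurable_frequently (P : nat -> set T) :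
  (forall n, measurable (P n)) ->
  measurable [set x | forall N, exists2 n, (N <= n)%N & P n x].
Proof.
move=> mP; rewrite (_ : [set x | _] =
    \bigcap_N \bigcup_(n in [set n | (N <= n)%N]) P n).
  by apply: bigcapT_measurable => N; apply: bigcup_measurable.
apply/seteqP; split=> x /= h N; first by move=> _; have [n ? ?] := h N; exists n.
by have [n ? ?] := h N I; exists n.
Qed.

Lemma measurable_cvg0 (f : nat -> T -> R) :
  (forall n, measurable_fun setT (f n)) ->
  measurable [set x | f n x @[n --> \oo] --> 0].
Proof.
move=> mf; rewrite (_ : [set x | _] = \bigcap_k
    ~` [set x | forall N, exists2 n, (N <= n)%N & k.+1%:R^-1 <= `|f n x|]).
  apply: bigcapT_measurable => k; apply: measurableC.
  apply: (measurable_frequently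
    (P := fun n => [set x | k.+1%:R^-1 <= `|f n x|])) => n.
  have mg : measurable_fun setT (fun x => `|f n x|).
    by apply: measurableT_comp => //; exact: mf.
  rewrite (_ : [set x | _] =
      setT `&` (fun x => `|f n x|) @^-1` `[k.+1%:R^-1, +oo[%classic).
    by apply: mg => //; exact: measurable_itv.
  by apply/funext => x; apply/propext; rewrite /= in_itv/= andbT; split=> [|[]].
apply/seteqP; split=> x /=.
  move=> /cvgr0Pnorm_lt fx k _ /= fk.
  have k0 : 0 < k.+1%:R^-1 :> R by rewrite invr_gt0.
  have [N _ NP] := fx _ k0; have [n Nn] := fk N.
  by rewrite leNgt => /negP; apply; exact: NP.
move=> H; apply/cvgr0Pnorm_lt => e e0.
have [k ke] : exists k, k.+1%:R^-1 < e.
  exists (Num.truncn e^-1); rewrite invf_plt ?posrE//; exact: truncnS_gt.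
have /existsNP[N HN] := H k I; exists N => // n /= Nn.
rewrite ltNge; apply/negP => efn; apply: HN; exists n => //.
by apply: le_trans efn; exact: ltW.
Qed.

Lemma not_cvg0 (f : nat -> R) : ~ (f @ \oo --> 0) ->
  exists2 e : R, 0 < e & forall N, exists2 n, (N <= n)%N & e <= `|f n|.
Proof.
move=> nf; apply: contrapT => ne; apply: nf; apply/cvgr0Pnorm_lt => e e0.
apply: contrapT => nN; apply: ne; exists e => // N; apply: contrapT => nn.
apply: nN; exists N => // n /= Nn; rewrite ltNge; apply/negP => efn.
by apply: nn; exists n.
Qed.

End cvg0_sets.

(** * Boundary behaviour and the singular parts *)

Section boundary_behaviour.
Context {R : realType} (h : R[i] -> R[i]).
Context (hh : herglotz h).
Context (mu : R -> {measure set (measurableTypeR R) -> \bar R}).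
Context (hmu : forall r : R, measure_of_herglotz (herglotz_family h r) (mu r)).

Local Notation leb := (@lebesgue_measure R).

Definition re_approach n (x : R) : R := complex.Re (h (x +i* (2 ^- n))).
Definition im_approach n (x : R) : R := complex.Im (h (x +i* (2 ^- n))).

Local Notation u := re_approach.
Local Notation v := im_approach.

Let y0 n : 0 < 2 ^- n :> R.
Proof. by rewrite invr_gt0 exprn_gt0. Qed.

Lemma im_approach_gt0 n x : 0 < v n x.
Proof. exact: Im_herglotz_gt0. Qed.

Lemma measurable_re_approach n : measurable_fun [set: measurableTypeR R] (u n).
Proof. exact: measurable_Re_herglotz. Qed.

Lemma measurable_im_approach n : measurable_fun [set: measurableTypeR R] (v n).
Proof. exact: measurable_Im_herglotz. Qed.

(** The imaginary part of [(r - h)^-1] at the point [x + i 2^-n]. *)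
Definition poisson_approach (r : R) n (x : R) : R := poisson (u n x) (v n x) r.

Lemma measurable_poisson_approach r n :
  measurable_fun [set: measurableTypeR R] (poisson_approach r n).
Proof.
apply: measurable_poisson => //.
- exact: measurable_re_approach.
- exact: measurable_im_approach.
Qed.

(** On the dyadic interval of length [2^-n] around [x], the Poisson kernel of
[x + i 2^-n] is at least [(2 * 2^-n)^-1]. *)
Lemma dyadic_le_poisson_approach r n x :
  (mu r (dyadic n (dyadic_index n x)) <=
   (2 * poisson_approach r n x * 2 ^- n)%:E)%E.
Proof.
set D : set (measurableTypeR R) := dyadic n (dyadic_index n x).
have mD : measurable D by exact: measurable_dyadic.
have c0 : 0 <= (2 * 2 ^- n)^-1 :> R by rewrite invr_ge0 mulr_ge0// ltW.
have : ((2 * 2 ^- n)^-1%:E * mu r D <= (poisson_approach r n x)%:E)%E.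
  apply: (@le_trans _ _ (\int[mu r]_l (poisson x (2 ^- n) l)%:E)%E); last first.
    by rewrite (integral_poisson_family hmu)// lee_fin gerBl mulr_ge0 ?linear_coef_ge0// ltW.
  have -> : mu r D = (\int[mu r]_l (\1_D l)%:E)%E by rewrite integral_indic ?setIT.
  have mI : measurable_fun setT (fun l : measurableTypeR R => (\1_D l : R)%:E).
    by apply/measurable_EFinP/measurable_indic.
  rewrite -ge0_integralZl//.
  apply: ge0_le_integral => //.
  - by apply: emeasurable_funM.
  - by apply/measurable_EFinP; apply: measurable_poisson => //; exact: measurable_cst.
  - move=> l _; rewrite -EFinM lee_fin indicE.
    have [lD|lD] := boolP (l \in D); last by rewrite mulr0 poisson_ge0// ltW.
    rewrite mulr1; apply: poisson_ge => //; apply/ltW/dyadic_dist.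
    by rewrite inE in lD.
by rewrite lee_pdivrMl ?mulr_gt0// -EFinM mulrAC.
Qed.

(** This plays the part of a differentiation theorem: a bound on the Poisson
integral at arbitrarily small heights bounds the measure. *)
Lemma le_measure_poisson_approach r (A : set (measurableTypeR R)) (c : R) :
  0 <= c -> measurable A -> (leb A < +oo)%E ->
  (forall x, A x -> forall N, exists2 n, (N <= n)%N & poisson_approach r n x <= c) ->
  (mu r A <= (2 * c)%:E * leb A)%E.
Proof.
move=> c0 mA Aoo Ac; apply: le_measure_dyadic_density => //; first exact: mulr_ge0.
move=> x Ax N; have [n Nn nc] := Ac x Ax N; exists n => //.
apply: le_trans (dyadic_le_poisson_approach r n x) _.
by rewrite lee_fin ler_pM2r// ler_pM2l.
Qed.

(** Letting [c] tend to [0] requires [A] to have finite Lebesgue measure, hence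
the decomposition into bounded pieces. *)
Lemma measure_poisson_approach0 r (A : set (measurableTypeR R)) :
  measurable A ->
  (forall c, 0 < c -> forall x, A x ->
     forall N, exists2 n, (N <= n)%N & poisson_approach r n x <= c) ->
  mu r A = 0%E.
Proof.
move=> mA Ac.
pose I k : set (measurableTypeR R) := `[(- k%:R), k%:R]%classic.
have mI k : measurable (I k) by exact: measurable_itv.
have AI k : mu r (A `&` I k) = 0%E.
  have mAI : measurable (A `&` I k) by exact: measurableI.
  have AIoo : (leb (A `&` I k) < +oo)%E.
    apply: (@le_lt_trans _ _ (leb (I k))).
      by apply: le_measure; rewrite ?inE//; exact: subIsetr.
    by rewrite lebesgue_measure_itv/=; case: ifP; rewrite ?ltry.
  apply/eqP; rewrite eq_le measure_ge0 andbT.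
  apply/lee_addgt0Pr => e e0; rewrite add0e.
  have AIfin : leb (A `&` I k) \is a fin_num by rewrite ge0_fin_numE.
  pose m := fine (leb (A `&` I k)).
  have m0 : 0 <= m by exact: fine_ge0.
  pose c := e / (2 * (m + 1)).
  have m1 : 0 < 2 * (m + 1) by lra.
  have c0 : 0 < c by rewrite divr_gt0.
  apply: le_trans (le_measure_poisson_approach (ltW c0) mAI AIoo _) _.
    by move=> x [Ax _]; exact: Ac.
  rewrite -(fineK AIfin) -EFinM lee_fin -/m.
  have : c * (2 * (m + 1)) = e by rewrite /c divfK// gt_eqF.
  nra.
have AE : A = \bigcup_k (A `&` I k).
  rewrite -setI_bigcupr; apply/esym/setIidl => x _.
  exists (Num.truncn `|x|).+1 => //; rewrite /I /= in_itv/= -ler_norml.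
  by rewrite ltW// truncnS_gt.
apply/(measure_negligible mA); rewrite AE; apply: negligible_bigcup => k.
by apply/negligibleP; [exact: measurableI|exact: AI].
Qed.

(** At the points of [A], the imaginary part of [(r - h)^-1] is at most
[v n x / d ^+ 2] for infinitely many [n], which is arbitrarily small. *)
Lemma measure_limit_ne r (A : set (measurableTypeR R)) :
  measurable A ->
  (forall x, A x -> v n x @[n --> \oo] --> 0) ->
  (forall x, A x -> exists2 d : R, 0 < d &
     forall N, exists2 n, (N <= n)%N & d <= `|r - u n x|) ->
  mu r A = 0%E.
Proof.
move=> mA Av Au; apply: measure_poisson_approach0 => // c c0 x Ax N.
have [d d0 dP] := Au x Ax.
have cd : 0 < c * d ^+ 2 by rewrite mulr_gt0// exprn_gt0.
have [M _ MP] := (cvgr0Pnorm_lt _).1 (Av x Ax) _ cd.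
have [n] := dP (maxn N M); rewrite geq_max => /andP[Nn Mn] dn.
exists n => //; have := MP n Mn.
rewrite ger0_norm; last exact/ltW/im_approach_gt0.
move=> vn; apply: le_trans (poisson_le_far (im_approach_gt0 n x) d0 dn) _.
by rewrite ler_pdivrMr ?exprn_gt0// ltW.
Qed.

(** Comparable to the modulus of [r - h (x + i 2^-n)]. *)
Definition approach_dist (r : R) n (x : R) : R := `|r - u n x| + v n x.

Definition limit_set (r : R) : set (measurableTypeR R) :=
  [set x | approach_dist r n x @[n --> \oo] --> 0].

Lemma measurable_limit_set r : measurable (limit_set r).
Proof.
apply: (measurable_cvg0 (f := approach_dist r)) => n; apply: measurable_funD.
  apply: measurableT_comp => //; apply: measurable_funB => //.
  exact: measurable_re_approach.
exact: measurable_im_approach.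
Qed.

Lemma poisson_approach_dist r n x :
  approach_dist r n x * poisson_approach r n x <= 2.
Proof.
have v0 := im_approach_gt0 n x.
have := poisson_le_dist (u n x) r v0; have := poisson_le_height (u n x) r v0.
have := poisson_ge0 (u n x) r (ltW v0).
rewrite /approach_dist /poisson_approach => p0 h1 h2.
have : 0 <= `|r - u n x| * poisson (u n x) (v n x) r by rewrite mulr_ge0.
lra.
Qed.

(** Where the imaginary part of [(r - h)^-1] does not tend to infinity, it is
bounded by some integer at arbitrarily small heights.  The points of a
Lebesgue-null carrier of the singular part where this happens form a null set
for [mu r], hence for the singular part. *)
Lemma singular_limit_set r (ms : {measure set (measurableTypeR R) -> \bar R}) :
  singular_part (mu r) ms -> ms (~` limit_set r) = 0%E.
Proof.
move=> [[N [mN msN lebN]] [muac [_ muE]]].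
pose A (k : nat) : set (measurableTypeR R) :=
  [set x | forall N, exists2 n, (N <= n)%N & poisson_approach r n x <= k%:R].
have mA k : measurable (A k).
  apply: (measurable_frequently (P := fun n => [set x | poisson_approach r n x <= k%:R])) => n.
  rewrite (_ : [set x | _] = setT `&` (poisson_approach r n) @^-1` `]-oo, k%:R]%classic).
    by apply: measurable_poisson_approach => //; exact: measurable_itv.
  by apply/funext => x; apply/propext; rewrite /= in_itv/=; split=> [|[]].
have msA k : ms (A k) = 0%E.
  have mAN : measurable (A k `\` N) by exact: measurableD.
  have lAN : leb (A k `\` N) = 0%E.
    by apply: subset_measure0 lebN => //; exact: measurableC.
    have := @le_measure_poisson_approach r (A k `\` N) k%:R (ler0n _ _) mAN.
  rewrite lAN mule0 => /(_ (ltry _)) H.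
  have /H : forall x, (A k `\` N) x ->
      forall M, exists2 n, (M <= n)%N & poisson_approach r n x <= k%:R.
    by move=> x [].
  rewrite muE// => H0.
  have msAN : ms (A k `\` N) = 0%E.
    apply/eqP; rewrite eq_le measure_ge0 andbT; apply: le_trans H0.
    exact: leeDr.
  have -> : ms (A k) = (ms (A k `\` N) + ms (A k `&` N))%E by exact: measureDI.
  rewrite msAN add0e.
  by apply: subset_measure0 msN => //; exact: measurableI.
have mL := measurable_limit_set r.
apply/(measure_negligible (measurableC mL)).
apply: (@negligibleS _ _ _ ms (\bigcup_k A k)); last first.
  by apply: negligible_bigcup => k; apply/negligibleP; [exact: mA|exact: msA].
move=> x; apply: contra_notP => nA; apply/cvgr0Pnorm_lt => e e0.
pose k := (Num.truncn (2 / e)).+1.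
have ke : 2 / e < k%:R by exact: truncnS_gt.
have nAk : ~ A k x by move=> Ak; apply: nA; exists k.
have /existsNP[M MP] := nAk; exists M => // n /= Mn.
have kp : k%:R < poisson_approach r n x.
  by rewrite ltNge; apply/negP => pk; apply: MP; exists n.
have d0 : 0 <= approach_dist r n x by rewrite addr_ge0// ltW// im_approach_gt0.
rewrite ger0_norm// ltNge; apply/negP => ed.
have := poisson_approach_dist r n x; rewrite ltr_pdivrMr// in ke.
rewrite leNgt => /negP; apply; apply: lt_le_trans ke _.
by rewrite mulrC; apply: ler_pM => //; [exact: ltW|exact: ltW].
Qed.

End boundary_behaviour.

(** * The average of the singular parts *)

Section singular_average.
Context {R : realType} (h : R[i] -> R[i]).
Context (hh : herglotz h).
Context (mu : R -> {measure set (measurableTypeR R) -> \bar R}).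
Context (hmu : forall r : R, measure_of_herglotz (herglotz_family h r) (mu r)).

Local Notation leb := (@lebesgue_measure R).
Local Notation u := (re_approach h).
Local Notation v := (im_approach h).

Let v0 := im_approach_gt0 hh.

Lemma cvg0_add_ge0 (f g : nat -> R) : (forall n, 0 <= f n) -> (forall n, 0 <= g n) ->
  f n + g n @[n --> \oo] --> 0 ->
  f n @[n --> \oo] --> 0 /\ g n @[n --> \oo] --> 0.
Proof.
move=> f0 g0 fg; split; apply: (squeeze_cvgr _ (cvg_cst 0) fg); apply: nearW => n.
  by rewrite f0 lerDl g0.
by rewrite g0 lerDr f0.
Qed.

Lemma approach_dist_cvg0 (w : nat -> R) (x : R) : (forall n, 0 <= w n) ->
  w n + v n x @[n --> \oo] --> 0 ->
  w n @[n --> \oo] --> 0 /\ v n x @[n --> \oo] --> 0.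
Proof. by move=> w0; apply: cvg0_add_ge0 => // n; exact: ltW. Qed.

Lemma measure_limit_set_ne (r s : R) : r != s -> mu r (limit_set h s) = 0%E.
Proof.
move=> rs; have rs0 : 0 < `|r - s| by rewrite normr_gt0 subr_eq0.
apply: (measure_limit_ne hh hmu); first exact: measurable_limit_set.
  by move=> x /approach_dist_cvg0[].
move=> x xl; have [//|su _] := approach_dist_cvg0 _ xl.
exists (`|r - s| / 2); first by rewrite divr_gt0.
move=> N; have rs2 : 0 < `|r - s| / 2 by rewrite divr_gt0.
have [M _ MP] := (cvgr0Pnorm_lt _).1 su _ rs2.
exists (maxn N M); first exact: leq_maxl.
have := MP (maxn N M) (leq_maxr _ _); rewrite normr_id => hs.
have := ler_distD (u (maxn N M) x) r s; rewrite (distrC (u _ _) s); lra.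
Qed.

(** By the averaging formula: [mu r] does not charge [limit_set h s] unless
[r = s]. *)
Lemma lebesgue_limit_set s : leb (limit_set h s) = 0%E.
Proof.
have mL := measurable_limit_set hh s.
rewrite -(integral_mu hh hmu)//.
transitivity (\int[leb]_(r in [set: measurableTypeR R]) (cst 0 r : \bar R))%E; last first.
  by rewrite integral0.
apply: ge0_ae_eq_integral => //; first exact: (measurable_mu hh hmu).
exists [set s]; split=> //; first exact: lebesgue_measure_set1.
move=> r /=; apply: contra_notP => /eqP rs _; exact: measure_limit_set_ne.
Qed.

Definition clamp (t : R) : R := Num.max 0 (Num.min t 1).

Lemma clamp_itv t : 0 <= clamp t <= 1.
Proof. by rewrite /clamp le_max lexx ge_max ler01 ge_min lexx orbT. Qed.

Lemma clamp_dist_le (r t : R) : 0 <= r <= 1 -> `|clamp t - t| <= `|r - t|.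
Proof.
move=> /andP[r0 r1]; rewrite /clamp; have [t1|t1] := leP t 1.
  have [t0|t0] := leP 0 t; first by rewrite subrr normr0.
  by rewrite !gtr0_norm ?subr_gt0//; lra.
by rewrite max_r// !ltr0_norm ?subr_lt0//; lra.
Qed.

(** The set where the distance of [h (x + i 2^-n)] to the segment [[0, 1]] tends
to [0].  It is measurable by its very form, and the sequence need not converge
at its points. *)
Definition limit_set01 : set (measurableTypeR R) :=
  [set x | `|clamp (u n x) - u n x| + v n x @[n --> \oo] --> 0].

Lemma measurable_limit_set01 : measurable limit_set01.
Proof.
apply: (measurable_cvg0 (f := fun n x => `|clamp (u n x) - u n x| + v n x)) => n.
have mu_ := measurable_re_approach hh n.
apply: measurable_funD; last exact: measurable_im_approach.
apply: measurableT_comp => //; apply: measurable_funB => //.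
by apply: measurable_maxr => //; exact: measurable_minr.
Qed.

Lemma limit_set_sub01 r : 0 <= r <= 1 -> limit_set h r `<=` limit_set01.
Proof.
move=> r01 x; rewrite /limit_set/= /approach_dist => rx.
apply: (squeeze_cvgr _ (cvg_cst 0) rx); apply: nearW => n.
by rewrite addr_ge0 ?(ltW (v0 _ _))//= lerD2r clamp_dist_le.
Qed.

Lemma measure_limit_set01_out r : ~~ (0 <= r <= 1) -> mu r limit_set01 = 0%E.
Proof.
move=> r01; pose d := Num.max (- r) (r - 1) / 2.
have d0 : 0 < d.
  rewrite divr_gt0// lt_max; move: r01; rewrite negb_and -!ltNge.
  by rewrite oppr_gt0 subr_gt0.
apply: (measure_limit_ne hh hmu); first exact: measurable_limit_set01.
  by move=> x /approach_dist_cvg0[].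
move=> x xl; have [//|cu _] := approach_dist_cvg0 _ xl; exists d => // N.
have [M _ MP] := (cvgr0Pnorm_lt _).1 cu _ d0.
exists (maxn N M); first exact: leq_maxl.
have := MP (maxn N M) (leq_maxr _ _); rewrite normr_id.
set t := u _ x => ct.
have := ler_distD t r (clamp t); rewrite (distrC t) => tri.
have : 2 * d <= `|r - clamp t|.
  have /andP[c0 c1] := clamp_itv t.
  rewrite /d mulrC divfK// ge_max; apply/andP; split.
    have := ler_norm (- (r - clamp t)); rewrite normrN; lra.
  have := ler_norm (r - clamp t); lra.
lra.
Qed.

Lemma measure_limit_set01_in r : 0 <= r <= 1 ->
  mu r (limit_set01 `\` limit_set h r) = 0%E.
Proof.
move=> r01; apply: (measure_limit_ne hh hmu).
- by apply: measurableD; [exact: measurable_limit_set01|exact: measurable_limit_set].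
- by move=> x [/approach_dist_cvg0[]].
move=> x [xE /not_cvg0[e e0 eP]]; have [//|_ vx] := approach_dist_cvg0 _ xE.
exists (e / 2) => [|N]; first by rewrite divr_gt0.
have e2 : 0 < e / 2 by rewrite divr_gt0.
have [M _ MP] := (cvgr0Pnorm_lt _).1 vx _ e2.
have [n] := eP (maxn N M); rewrite geq_max => /andP[Nn Mn] en.
exists n => //; have := MP n Mn; rewrite ger0_norm ?(ltW (v0 _ _))// => vn.
move: en; rewrite /approach_dist ger0_norm; last by rewrite addr_ge0// ltW.
lra.
Qed.

(** Inside [limit_set01], [mu r] is carried by the Lebesgue-null set
[limit_set h r], where its absolutely continuous part vanishes and where its
singular part has all its mass. *)
Lemma singular_part_limit_set01 r (ms : {measure set (measurableTypeR R) -> \bar R})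
    (A : set (measurableTypeR R)) :
  0 <= r <= 1 -> singular_part (mu r) ms -> measurable A ->
  ms A = mu r (A `&` limit_set01).
Proof.
move=> r01 sms mA.
have mL := measurable_limit_set hh r; have mE := measurable_limit_set01.
have msL := singular_limit_set hh hmu sms.
have lL := lebesgue_limit_set r.
have [_ [muac [ac muE]]] := sms.
have mAE : measurable (A `&` limit_set01) by exact: measurableI.
have mAL : measurable (A `&` limit_set h r) by exact: measurableI.
have -> : mu r (A `&` limit_set01) = mu r (A `&` limit_set h r).
  have -> : mu r (A `&` limit_set01) =
      (mu r ((A `&` limit_set01) `\` limit_set h r) +
       mu r ((A `&` limit_set01) `&` limit_set h r))%E by exact: measureDI.
  have -> : mu r ((A `&` limit_set01) `\` limit_set h r) = 0%E.
    apply: subset_measure0 (measure_limit_set01_in r01).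
    - exact: measurableD.
    - exact: measurableD.
    - by move=> x [[]].
  rewrite add0e -setIA; congr (mu r (_ `&` _)).
  exact/setIidr/limit_set_sub01.
rewrite muE//.
have -> : muac (A `&` limit_set h r) = 0%E.
  apply: (ac (limit_set h r)) => // B mB BL; exact: subset_measure0 lL.
rewrite add0e.
have -> : ms A = (ms (A `\` limit_set h r) + ms (A `&` limit_set h r))%E
  by exact: measureDI.
have -> : ms (A `\` limit_set h r) = 0%E.
  apply: subset_measure0 msL; [exact: measurableD|exact: measurableC|].
  by move=> x [].
by rewrite add0e.
Qed.

Lemma integral01_limit_set01 (A : set (measurableTypeR R)) : measurable A ->
  (\int[leb]_(r in `[0%R, 1%R]%classic) mu r (A `&` limit_set01) =
   leb (A `&` limit_set01))%E.
Proof.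
move=> mA; have mE := measurable_limit_set01.
rewrite -[RHS](integral_mu hh hmu); last exact: measurableI.
rewrite integral_mkcond; apply: eq_integral => r _; rewrite patchE.
case: ifPn => // r01; apply/esym.
apply: subset_measure0 (measure_limit_set01_out _) => //.
  exact: measurableI.
by apply: contra r01 => r01; rewrite inE/= in_itv.
Qed.

End singular_average.


Unset Implicit Arguments.

Theorem theorem1 (R : realType) (h : R[i] -> R[i]) (hh : herglotz h)
    (mu mus : R -> {measure set (measurableTypeR R) -> \bar R})
    (hmu : forall r : R, measure_of_herglotz (herglotz_family h r) (mu r))
    (hmus : forall r : R, singular_part (mu r) (mus r)) :
  (forall r : R, herglotz (herglotz_family h r)) /\
  exists nu : {measure set (measurableTypeR R) -> \bar R},
    [/\ averaged_measure mus nu,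
        nu `<< lebesgue_measure
      & exists f : R -> R,
          density nu f /\
          {ae lebesgue_measure, forall x : measurableTypeR R,
             f x = 0 \/ f x = 1} ].
Proof.
split; first by move=> r; exact: herglotz_family_herglotz.
have mE := measurable_limit_set01 hh; set E := limit_set01 h in mE.
exists (mrestr lebesgue_measure mE); split.
- move=> A mA.
  have mAE : measurable (A `&` E) by exact: measurableI.
  have musE : {in `[0, 1]%classic, (fun r => mu r (A `&` E)) =1 (fun r => mus r A)}.
    move=> r; rewrite inE/= in_itv/= => r01.
    by rewrite (singular_part_limit_set01 hh hmu r01 (hmus r) mA).
  split.
    apply: (eq_measurable_fun _ musE); apply: measurable_funTS.
    exact: (measurable_mu hh hmu).
  apply: etrans (esym (integral01_limit_set01 hh hmu mA)) _.
  by apply: eq_integral => r r01; rewrite musE.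
- move=> N N0 A mA AN; rewrite /= /mrestr.
  apply: (N0 (A `&` E)); first exact: measurableI.
  by move=> x [/AN].
- exists \1_E; split; last by apply: aeW => x; rewrite indicE; case: (_ \in _); [right|left].
  split.
  + exact: measurable_indic.
  + by move=> x; rewrite indicE.
  + by move=> A mA; rewrite integral_indic// setIC.
Qed.
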